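(* There exists a function $\phi_0\in\mathscr S(\mathbb R)$ with $\|\phi_0\|_{L^2(\mathbb R)}=1$ such that $$\iint_{x\ge 0,\ \xi\ge 0}\mathcal W(\phi_0,\phi_0)(x,\xi)\,dx\,d\xi>1 .$$ Moreover, there exists $a>0$ such that $$\iint_{0\le x\le a,\ 0\le \xi\le a}\mathcal W(\phi_0,\phi_0)(x,\xi)\,dx\,d\xi>1 .$$
   Context: $\mathscr S(\mathbb R)$ is the Schwartz space. For $u,v\in L^2(\mathbb R)$ the (joint) Wigner distribution is $\mathcal W(u,v)(x,\xi)=\int_{\mathbb R}e^{-2i\pi z\xi}\,u(x+\tfrac z2)\,\overline{v(x-\tfrac z2)}\,dz$ for $(x,\xi)\in\mathbb R^2$; $\mathcal W(u,u)$ is real-valued, and $\mathcal W(u,u)\in\mathscr S(\mathbb R^2)$ when $u\in\mathscr S(\mathbb R)$. *)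

(* Defs.v *)
From HB Require Import structures.
From mathcomp Require Import all_boot all_order all_algebra.
From mathcomp Require Import complex.
From mathcomp Require Import all_classical all_reals all_analysis.
Import Order.TTheory GRing.Theory Num.Theory.
Export numFieldNormedType.Exports.

Set Implicit Arguments.
Unset Strict Implicit.
Unset Printing Implicit Defensive.

Local Open Scope classical_set_scope.
Local Open Scope complex_scope.
Local Open Scope ring_scope.

(* The library gives R[i] no R-normed-module structure and no integral, so
   derivatives along R and integrals of R[i]-valued functions are taken on real
   and imaginary parts. *)

Definition cderiven (R : realType) (n : nat) (u : R -> R[i]) (x : R) : R[i] :=
  derive1n n (fun t => complex.Re (u t)) x +i*
  derive1n n (fun t => complex.Im (u t)) x.

Definition csmooth (R : realType) (u : R -> R[i]) : Prop :=
  forall (n : nat) (x : R),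
    derivable (derive1n n (fun t => complex.Re (u t))) x 1 /\
    derivable (derive1n n (fun t => complex.Im (u t))) x 1.

Definition schwartz (R : realType) (u : R -> R[i]) : Prop :=
  csmooth u /\
  forall k n : nat, exists M : R, forall x : R,
    `|x| ^+ k * Normc.normc (cderiven n u x) <= M.

(* The real integrals are 0 when infinite (or of the form oo - oo), so an
   inequality 1 < Cintegral mu D f is never due to a divergent integral.
   In the order of R[i], 1 < z means Im z = 0 and 1 < Re z. *)
Definition Cintegral (d : measure_display) (T : measurableType d)
    (R : realType) (mu : {measure set T -> \bar R}) (D : set T)
    (f : T -> R[i]) : R[i] :=
  (\int[mu]_(t in D) complex.Re (f t)) +i* (\int[mu]_(t in D) complex.Im (f t)).

Definition cL2norm (R : realType) (u : R -> R[i]) : \bar R :=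
  ('N[@lebesgue_measure R]_2%:E[EFin \o (fun x => Normc.normc (u x))])%E.

Definition expi (R : realType) (t : R) : R[i] := cos t +i* sin t.

Definition wigner (R : realType) (u v : R -> R[i]) (p : R * R) : R[i] :=
  Cintegral (@lebesgue_measure R) setT (fun z : R =>
    expi (- (2 * pi * z * p.2)) * u (p.1 + z / 2) * conjc (v (p.1 - z / 2))).

(* Main.v *)
Require Import Defs.
From mathcomp Require Import all_boot all_order all_algebra.
From mathcomp Require Import complex.
From mathcomp Require Import all_classical all_reals all_analysis.
From mathcomp Require Import measurable_realfun ring lra.

(** Let f and g be the coherent states centred at the phase-space points (r, r)
    and (-r, -r), and let u = f + eps g with eps > 0 small.  The Wigner
    distribution of u is the sum of a Gaussian bump at each centre and of an
    interference term, which is a Gaussian at the midpoint of the centres, the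
    origin, multiplied by 2 eps cos (4 pi r (x - xi)).  The origin is the corner
    of the quadrant.

    The quadrant contains the bump of f up to a relative error of order
    q = exp (- 2 pi r^2).  Over the whole plane the interference term integrates
    to almost nothing, because f and g are almost orthogonal; but cutting an
    oscillating Gaussian sharply at its centre leaves a boundary contribution
    that is only polynomially small.  Precisely, expanding the cosine turns the
    interference term into tensor squares, and its integral over the quadrant is
    bounded below by a multiple of eps S^2, where S is the integral over
    [0, +oo[ of exp (- 2 pi x^2) sin (4 pi r x), of order 1 / (4 pi r).  So the
    quadrant gains a term of first order in eps, while the squared norm of u
    grows only by eps^2.  Once q is negligible compared with S^4, a suitable eps
    makes the normalized integral exceed 1; r = 3 and eps = 1/2500 will do.

    The Wigner distribution is computed exactly with the Fourier transform of a
    Gaussian ([fourier_gaussian_cos], [wigner_coherent_pair]).  The essential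
    estimate is the lower bound on S ([halfline_sin_gaussian_ge]); both it and
    the Fourier transform come from a first-order differential equation in the
    frequency, in the half-line case with a nonzero right-hand side.  They are
    combined with the numerical values in [quadrant_wigner_pair_gt1].  The
    squares [0, a] x [0, a] exhaust the quadrant, so by dominated convergence the
    inequality persists on a large square ([square_wigner_pair_gt1]). *)

Import Order.TTheory GRing.Theory Num.Theory.

Set Implicit Arguments.
Unset Strict Implicit.
Unset Printing Implicit Defensive.

Local Open Scope classical_set_scope.
Local Open Scope ring_scope.

(** * Exhaustion of a domain and primitives on unbounded intervals *)

(** Dominated convergence for the restrictions of f, with |f| itself as the
    dominating function.  It turns the fundamental theorem of calculus on
    segments into statements on R and on [0, +oo[, and in the plane it compares
    the squares [0, a] x [0, a] with the quadrant. *)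
Lemma cvg_Rintegral_exhaust d (T : measurableType d) (R : realType)
    (mu : {measure set T -> \bar R}) (D : set T) (E : nat -> set T) (f : T -> R) :
  measurable D -> (forall n, measurable (E n)) -> (forall n, E n `<=` D) ->
  (forall x, D x -> \forall n \near \oo, E n x) ->
  mu.-integrable D (EFin \o f) ->
  \int[mu]_(x in E n) f x @[n --> \oo] --> \int[mu]_(x in D) f x.
Proof.
move=> mD mE ED evE fi.
have mf : measurable_fun D f by apply/measurable_EFinP; exact: measurable_int fi.
rewrite (_ : (fun n => _) =
    (fun n => fine (\int[mu]_(x in D) ((f \_ (E n)) x)%:E)%E)); last first.
  apply/funext => n; rewrite -[LHS]/(Rintegral _ _ _) -[E n in LHS](setIidr (ED n)).
  by rewrite Rintegral_mkcondr.
apply: fine_cvg.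
rewrite /Rintegral fineK; last exact: integrable_fin_num.
apply: (@dominated_cvg _ _ _ mu D mD _ (EFin \o f) (fun x => `|f x|%:E)) => //.
- move=> n; apply/measurable_EFinP.
  by apply/(measurable_restrict _ (mE n) mD); apply: measurable_funS mf => // x [].
- move=> x Dx; apply: cvg_near_cst.
  near=> n; rewrite patchE ifT//; apply/mem_set; near: n; exact: evE.
- by have := integrable_abse fi.
- by move=> n x Dx; rewrite lee_fin patchE; case: ifP => // _; rewrite normr0.
Unshelve. all: by end_near. Qed.

Lemma integrable_EFinZl d (T : measurableType d) (R : realType)
    (mu : {measure set T -> \bar R}) (D : set T) (k : R) (f : T -> R) :
  measurable D -> mu.-integrable D (EFin \o f) ->
  mu.-integrable D (EFin \o (fun x => k * f x)).
Proof.
move=> mD fi; rewrite (_ : _ \o _ = fun x => (k%:E * (f x)%:E)%E)//.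
exact: integrableZl.
Qed.

Lemma integrable_EFinD d (T : measurableType d) (R : realType)
    (mu : {measure set T -> \bar R}) (D : set T) (f g : T -> R) :
  measurable D -> mu.-integrable D (EFin \o f) ->
  mu.-integrable D (EFin \o g) ->
  mu.-integrable D (EFin \o (fun x => f x + g x)).
Proof.
move=> mD fi gi; rewrite (_ : _ \o _ = ((EFin \o f) \+ (EFin \o g))%E)//.
exact: integrableD.
Qed.

Section primitive.
Context {R : realType}.
Notation mu := (@lebesgue_measure R).
Implicit Types f F : R -> R.

Lemma is_derive_continuous (f df : R -> R) :
  (forall x : R, is_derive x 1 f (df x)) -> continuous f.
Proof.
move=> dF x; apply: differentiable_continuous.
by apply/derivable1_diffP; case: (dF x).
Qed.

Lemma Rintegral_is_derive f F (a b : R) : a < b -> continuous f ->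
  (forall x : R, is_derive x 1 F (f x)) ->
  \int[mu]_(x in `[a, b]) f x = F b - F a.
Proof.
move=> ab cf dF.
have cF := is_derive_continuous dF.
rewrite /Rintegral (@continuous_FTC2 R f F a b)//.
- exact: continuous_subspaceT.
- split.
  + by move=> x _; case: (dF x).
  + exact: cvg_at_right_filter (cF a).
  + exact: cvg_at_left_filter (cF b).
- by move=> x _; rewrite derive1E; apply: derive_val.
Qed.

Lemma Rintegral_derive_line f F : continuous f ->
  mu.-integrable setT (EFin \o f) -> (forall x : R, is_derive x 1 F (f x)) ->
  F n%:R @[n --> \oo] --> (0 : R) -> F (- n%:R) @[n --> \oo] --> (0 : R) ->
  \int[mu]_x f x = 0.
Proof.
move=> cf fi dF Fp Fm.
have h : \int[mu]_(x in `[(- n.+1%:R), n.+1%:R]) f x @[n --> \oo]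
    --> \int[mu]_x f x.
  apply: cvg_Rintegral_exhaust => //= x _; near=> n.
  rewrite in_itv/= -ler_norml ltW//; apply: lt_trans (_ : n%:R < _);
    last by rewrite ltr_nat.
  near: n; exact: nbhs_infty_gtr.
apply: (cvg_unique _ h) => //=.
rewrite (_ : (fun n => _) = (fun n => F n.+1%:R - F (- n.+1%:R))); last first.
  apply/funext => n; rewrite -[LHS]/(Rintegral _ _ _).
  apply: Rintegral_is_derive => //.
  by rewrite (@lt_trans _ _ 0) ?oppr_lt0.
rewrite -(subrr 0); apply: cvgB.
- by have := Fp; rewrite -(cvg_shiftS (fun n => F n%:R)).
- by have := Fm; rewrite -(cvg_shiftS (fun n => F (- n%:R))).
Unshelve. all: by end_near. Qed.

Lemma Rintegral_derive_halfline f F : continuous f ->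
  mu.-integrable setT (EFin \o f) -> (forall x : R, is_derive x 1 F (f x)) ->
  F n%:R @[n --> \oo] --> (0 : R) ->
  \int[mu]_(x in [set x | 0 <= x]) f x = - F 0.
Proof.
move=> cf fi dF Fp.
have mpos : measurable [set x : R | 0 <= x].
  by rewrite -set_itvcy; exact: measurable_itv.
have h : \int[mu]_(x in `[0, n.+1%:R]) f x @[n --> \oo]
    --> \int[mu]_(x in [set x | 0 <= x]) f x.
  apply: cvg_Rintegral_exhaust => //=.
  - by move=> n x /=; rewrite in_itv/= => /andP[].
  - move=> x x0; near=> n; rewrite in_itv/= x0/= ltW//.
    apply: lt_trans (_ : n%:R < _); last by rewrite ltr_nat.
    by near: n; exact: nbhs_infty_gtr.
  - exact: integrableS fi.
apply: (cvg_unique _ h) => //=.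
rewrite (_ : (fun n => _) = (fun n => F n.+1%:R - F 0)); last first.
  apply/funext => n; rewrite -[LHS]/(Rintegral _ _ _).
  exact: Rintegral_is_derive.
rewrite -[X in _ --> X]add0r; apply: cvgB; last exact: cvg_cst.
by have := Fp; rewrite -(cvg_shiftS (fun n => F n%:R)).
Unshelve. all: by end_near. Qed.

End primitive.

(** * Gaussians *)

Definition gaussian (R : realType) (c a x : R) : R := expR (- (c * (x - a) ^+ 2)).

Section gaussian.
Context {R : realType}.
Notation mu := (@lebesgue_measure R).
Implicit Types (a b c t x : R) (D : set R).

Lemma gaussian_gt0 c a x : 0 < gaussian c a x.
Proof. exact: expR_gt0. Qed.

Lemma is_derive_gaussian c a x :
  is_derive (x : R) 1 (gaussian c a) (- (2 * c * (x - a)) * gaussian c a x).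
Proof.
have h : is_derive (x : R) 1 (fun x : R => - (c * (x - a) ^+ 2)) (- (2 * c * (x - a))).
  apply: is_derive_eq; rewrite /GRing.scale/=; ring.
have := is_derive1_comp (is_derive_expR _) h.
by rewrite mulrC.
Qed.

Lemma is_derive_cos_affine b t x :
  is_derive (x : R) 1 (fun x : R => cos (b * x + t)) (- (b * sin (b * x + t))).
Proof.
have h : is_derive (x : R) 1 (fun x : R => b * x + t) b.
  apply: is_derive_eq; rewrite /GRing.scale/=; ring.
have := is_derive1_comp (is_derive_cos _) h.
by rewrite mulNr mulrC.
Qed.

Lemma is_derive_sin_affine b t x :
  is_derive (x : R) 1 (fun x : R => sin (b * x + t)) (b * cos (b * x + t)).
Proof.
have h : is_derive (x : R) 1 (fun x : R => b * x + t) b.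
  apply: is_derive_eq; rewrite /GRing.scale/=; ring.
have := is_derive1_comp (is_derive_sin _) h.
by rewrite mulrC.
Qed.

Lemma continuous_gaussian c a : continuous (gaussian c a).
Proof. exact: is_derive_continuous (is_derive_gaussian c a). Qed.

Lemma gaussian_normal_pdf c a : 0 < c ->
  gaussian c a =
  fun x => Num.sqrt (pi / c) * normal_pdf a (Num.sqrt (2 * c)^-1) x.
Proof.
move=> c0; apply/funext => x.
have c20 : 0 < (2 * c)^-1 by rewrite invr_gt0 mulr_gt0.
rewrite normal_pdfE ?gt_eqF ?sqrtr_gt0// /normal_peak /normal_fun.
rewrite sqr_sqrtr ?ltW//.
rewrite (_ : (2 * c)^-1 * pi *+ 2 = pi / c); last by field; lra.
rewrite mulrA mulfV ?mul1r; last by rewrite gt_eqF// sqrtr_gt0 divr_gt0// pi_gt0.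
by rewrite /gaussian; congr expR; field; lra.
Qed.

Lemma integrable_gaussian c a : 0 < c -> mu.-integrable setT (EFin \o gaussian c a).
Proof.
move=> c0; rewrite gaussian_normal_pdf//.
rewrite (_ : _ \o _ = fun x => ((Num.sqrt (pi / c))%:E *
  (normal_pdf a (Num.sqrt (2 * c)^-1) x)%:E)%E)//.
by apply: integrableZl => //; exact: integrable_normal_pdf.
Qed.

Lemma Rintegral_gaussian c a : 0 < c ->
  \int[mu]_x gaussian c a x = Num.sqrt (pi / c).
Proof.
move=> c0; rewrite gaussian_normal_pdf// RintegralZl//.
  by rewrite /Rintegral integral_normal_pdf/= mulr1.
exact: integrable_normal_pdf.
Qed.

(** The integrability criterion on the line: all integrands there are continuous
    and dominated by a Gaussian. *)
Lemma integrable_le_gaussian c a k D (f : R -> R) : measurable D -> 0 < c ->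
  continuous f -> (forall x, `|f x| <= k * gaussian c a x) ->
  mu.-integrable D (EFin \o f).
Proof.
move=> mD c0 cf fk.
apply: (@integrableS _ _ _ _ setT) => //.
apply: (le_integrable measurableT _ _
  (integrableZl measurableT k (integrable_gaussian a c0))).
- by apply/measurable_EFinP; exact: continuous_measurable_fun.
- move=> x _ /=; rewrite lee_fin.
  by rewrite (le_trans (fk x))// ler_norm.
Qed.

(** Half of the exponent absorbs the linear factor, since
    exp (c s^2 / 2) >= 1 + c s^2 / 2 and (1 + 1/c) (1 + c s^2 / 2) >= |s|.  The
    bound does not involve a frequency, so it dominates the derivative under
    the integral sign. *)
Lemma gaussian_moment1 c a x : 0 < c ->
  `|(x - a) * gaussian c a x| <= (1 + c^-1) * gaussian (c / 2) a x.
Proof.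
move=> c0.
rewrite normrM (gtr0_norm (gaussian_gt0 _ _ _)).
rewrite (_ : gaussian c a x = gaussian (c / 2) a x * gaussian (c / 2) a x); last first.
  by rewrite /gaussian -expRD; congr expR; field.
rewrite mulrA ler_pM2r ?gaussian_gt0//.
rewrite /gaussian expRN ler_pdivrMr ?expR_gt0//.
have h := expR_ge1Dx (c / 2 * (x - a) ^+ 2).
have c1 : 0 < 1 + c^-1 by rewrite addr_gt0// invr_gt0.
apply: le_trans (_ : (1 + c^-1) * (1 + c / 2 * (x - a) ^+ 2) <= _); last first.
  by rewrite ler_pM2l.
rewrite -[(x - a) ^+ 2]real_normK ?num_real//.
set s := `|x - a|.
rewrite -subr_ge0.
rewrite (_ : _ - _ = c^-1 + c / 2 * s ^+ 2 + 2^-1 * (1 + (s - 1) ^+ 2));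
  last by field; lra.
have := sqr_ge0 s; have := sqr_ge0 (s - 1).
move=> h1 h2; apply: addr_ge0; last by apply: mulr_ge0 => //; lra.
apply: addr_ge0; first by rewrite invr_ge0 ltW.
by apply: mulr_ge0 => //; lra.
Qed.

(** The tangent inequality t^2 >= 2 t - 1 at t = n - a bounds the sequence by a
    geometric one. *)
Lemma cvg_gaussian_nat c a : 0 < c -> gaussian c a n%:R @[n --> \oo] --> (0 : R).
Proof.
move=> c0.
have ge0 : 0 <= expR (- (2 * c)) by exact: expR_ge0.
have lt1 : `|expR (- (2 * c))| < 1.
  by rewrite ger0_norm// expR_lt1; lra.
have h : expR (c + 2 * c * a) * expR (- (2 * c)) ^+ n @[n --> \oo] --> (0 : R).
  by rewrite -(mulr0 (expR (c + 2 * c * a))); apply: cvgMr; exact: cvg_expr.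
apply: (squeeze_cvgr _ (cvg_cst (0 : R)) h).
apply: nearW => n; rewrite ltW ?gaussian_gt0//=.
rewrite -expRM_natl -expRD ler_expR.
rewrite -subr_ge0.
rewrite (_ : _ - _ = c * (n%:R - a - 1) ^+ 2); last by rewrite -mulr_natr; ring.
by rewrite mulr_ge0 ?sqr_ge0// ltW.
Qed.

Lemma cvg_gaussian_opp_nat c a : 0 < c -> gaussian c a (- n%:R) @[n --> \oo] --> (0 : R).
Proof.
move=> c0; have := @cvg_gaussian_nat c (- a) c0.
rewrite (_ : (fun n => gaussian c (- a) _) = (fun n => gaussian c a (- n%:R)))//.
by apply/funext => n; rewrite /gaussian; congr (expR (- (c * _))); ring.
Qed.

End gaussian.

(** * Fourier integrals of Gaussians *)

Section fourier.
Context {R : realType}.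
Notation mu := (@lebesgue_measure R).
Implicit Types (a b c t x : R) (D : set R).

Lemma normr_cos_le1 x : `|cos x| <= 1.
Proof. by rewrite ler_norml cos_geN1 cos_le1. Qed.

Lemma normr_sin_le1 x : `|sin x| <= 1.
Proof. by rewrite ler_norml sin_geN1 sin_le1. Qed.

Lemma continuous_cos_affine b t : continuous (fun x : R => cos (b * x + t)).
Proof. exact: is_derive_continuous (is_derive_cos_affine b t). Qed.

Lemma continuous_sin_affine b t : continuous (fun x : R => sin (b * x + t)).
Proof. exact: is_derive_continuous (is_derive_sin_affine b t). Qed.

Lemma continuous_gaussian_cos c a b t :
  continuous (fun x => gaussian c a x * cos (b * (x - a) + t)).
Proof.
move=> x; apply: cvgM; first exact: continuous_gaussian.
under eq_fun do rewrite mulrBr -addrA.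
rewrite mulrBr -addrA; exact: continuous_cos_affine.
Qed.

Lemma continuous_gaussian_sin c a b t :
  continuous (fun x => gaussian c a x * sin (b * (x - a) + t)).
Proof.
move=> x; apply: cvgM; first exact: continuous_gaussian.
under eq_fun do rewrite mulrBr -addrA.
rewrite mulrBr -addrA; exact: continuous_sin_affine.
Qed.

Lemma continuous_gaussian_sin1 c a b t :
  continuous (fun x => (x - a) * (gaussian c a x * sin (b * (x - a) + t))).
Proof.
move=> x; apply: cvgM; last exact: continuous_gaussian_sin.
by apply: cvgB; [exact: cvg_id|exact: cvg_cst].
Qed.

Lemma integrable_gaussian_cos c a b t D : measurable D -> 0 < c ->
  mu.-integrable D (EFin \o (fun x => gaussian c a x * cos (b * (x - a) + t))).
Proof.
move=> mD c0; apply: (@integrable_le_gaussian _ c a 1) => //.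
  exact: continuous_gaussian_cos.
move=> x; rewrite mul1r normrM gtr0_norm ?gaussian_gt0//.
by rewrite ler_piMr ?normr_cos_le1// ltW// gaussian_gt0.
Qed.

Lemma gaussian_sin1_le c a b t x : 0 < c ->
  `|(x - a) * (gaussian c a x * sin (b * (x - a) + t))| <=
  (1 + c^-1) * gaussian (c / 2) a x.
Proof.
move=> c0; rewrite mulrA normrM.
apply: le_trans (gaussian_moment1 a x c0).
by rewrite ler_piMr ?normr_sin_le1.
Qed.

Lemma integrable_gaussian_sin1 c a b t D : measurable D -> 0 < c ->
  mu.-integrable D (EFin \o
    (fun x => (x - a) * (gaussian c a x * sin (b * (x - a) + t)))).
Proof.
move=> mD c0; apply: (@integrable_le_gaussian _ (c / 2) a (1 + c^-1)) => //.
- by rewrite divr_gt0.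
- exact: continuous_gaussian_sin1.
- by move=> x; exact: gaussian_sin1_le.
Qed.

(** Differentiation under the integral sign in the frequency b; together with
    an integration by parts in x it yields a first-order linear differential
    equation in b for the integral. *)
Lemma is_derive_Rintegral_gaussian_cos c a t D b : measurable D -> 0 < c ->
  is_derive (b : R) 1
    (fun b => \int[mu]_(x in D) (gaussian c a x * cos (b * (x - a) + t)))
    (- \int[mu]_(x in D) ((x - a) * (gaussian c a x * sin (b * (x - a) + t)))).
Proof.
move=> mD c0.
pose f b x := gaussian c a x * cos (b * (x - a) + t).
have df x y : is_derive (x : R) 1 (f ^~ y)
    (- ((y - a) * (gaussian c a y * sin (x * (y - a) + t)))).
  have := is_derive_cos_affine (y - a) t x.
  rewrite (_ : (fun x => _) = (fun x => cos (x * (y - a) + t))); last first.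
    by apply/funext => z; rewrite mulrC.
  move=> h; apply: is_derive_eq; rewrite /GRing.scale/= (mulrC x); ring.
have bI : `]b - 1, b + 1[%classic b by rewrite /= in_itv/=; apply/andP; split; lra.
have fi x : `]b - 1, b + 1[%classic x -> mu.-integrable D (EFin \o f x).
  by move=> _; exact: integrable_gaussian_cos.
have fd x y : `]b - 1, b + 1[%classic x -> D y -> derivable (f ^~ y) x 1.
  by move=> _ _; case: (df x y).
pose G x := (1 + c^-1) * gaussian (c / 2) a x.
have G0 y : 0 <= G y.
  by rewrite /G mulr_ge0 ?(ltW (gaussian_gt0 _ _ _))// addr_ge0// invr_ge0 ltW.
have iG : mu.-integrable D (EFin \o G).
  apply: (@integrable_le_gaussian _ (c / 2) a (1 + c^-1)) => //.
  - by rewrite divr_gt0.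
  - by move=> x; apply: cvgM; [exact: cvg_cst|exact: continuous_gaussian].
  - by move=> x; rewrite ger0_norm.
have Gub x y : `]b - 1, b + 1[%classic x -> D y -> `|partial1of2 f x y| <= G y.
  move=> _ _; rewrite partial1of2E (@derive_val _ _ _ _ _ _ _ (df x y)) normrN.
  exact: gaussian_sin1_le.
have dF := derivable_under_integral (mu := mu) mD bI fi fd G0 iG Gub.
have FE := differentiation_under_integral (mu := mu) mD bI fi fd G0 iG Gub.
apply: DeriveDef; first exact: dF.
rewrite -derive1E FE.
rewrite -mulN1r -RintegralZl//; last exact: integrable_gaussian_sin1.
by apply: eq_Rintegral => y _; rewrite partial1of2E (@derive_val _ _ _ _ _ _ _ (df b y)) mulN1r.
Qed.

Lemma is_derive_gaussian_sin c a b t x :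
  is_derive (x : R) 1 (fun x => gaussian c a x * sin (b * (x - a) + t))
   (- (2 * c) * ((x - a) * (gaussian c a x * sin (b * (x - a) + t))) +
    b * (gaussian c a x * cos (b * (x - a) + t))).
Proof.
have := is_derive_sin_affine b (t - b * a) x.
rewrite (_ : (fun x => _) = (fun x => sin (b * (x - a) + t))); last first.
  by apply/funext => z; congr sin; ring.
rewrite (_ : b * x + _ = b * (x - a) + t); last by ring.
move=> h; have h2 := is_derive_gaussian c a x.
by apply: is_derive_eq; rewrite /GRing.scale/=; ring.
Qed.

Let dg c a b t x := - (2 * c) * ((x - a) * (gaussian c a x * sin (b * (x - a) + t))) +
    b * (gaussian c a x * cos (b * (x - a) + t)).

Let continuous_dg c a b t : continuous (dg c a b t).
Proof.
move=> x; apply: cvgD; apply: cvgM; try exact: cvg_cst.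
- exact: continuous_gaussian_sin1.
- exact: continuous_gaussian_cos.
Qed.

Let integrable_dg c a b t D : measurable D -> 0 < c ->
  mu.-integrable D (EFin \o dg c a b t).
Proof.
move=> mD c0.
apply: integrable_EFinD => //.
- by apply: integrable_EFinZl => //; exact: integrable_gaussian_sin1.
- by apply: integrable_EFinZl => //; exact: integrable_gaussian_cos.
Qed.

Let Rintegral_dg c a b t D : measurable D -> 0 < c ->
  \int[mu]_(x in D) dg c a b t x =
  - (2 * c) * \int[mu]_(x in D) ((x - a) * (gaussian c a x * sin (b * (x - a) + t)))
  + b * \int[mu]_(x in D) (gaussian c a x * cos (b * (x - a) + t)).
Proof.
move=> mD c0.
have i1 := integrable_gaussian_sin1 a b t mD c0.
have i2 := integrable_gaussian_cos a b t mD c0.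
rewrite /dg RintegralD//.
- by rewrite !RintegralZl.
- exact: integrable_EFinZl.
- exact: integrable_EFinZl.
Qed.

Let cvg_gaussian_sin c a b t (u : nat -> R) :
  gaussian c a (u n) @[n --> \oo] --> (0 : R) ->
  gaussian c a (u n) * sin (b * (u n - a) + t) @[n --> \oo] --> (0 : R).
Proof.
move=> gu; apply: norm_cvg0; apply: (squeeze_cvgr _ (cvg_cst (0 : R)) gu).
apply: nearW => n; rewrite normr_ge0/= normrM gtr0_norm ?gaussian_gt0//.
by rewrite ler_piMr ?normr_sin_le1// ltW// gaussian_gt0.
Qed.

(** The integral over R of the derivative of
    gaussian c a x * sin (b * (x - a) + t) vanishes. *)
Lemma gaussian_parts_line c a b t : 0 < c ->
  b * \int[mu]_x (gaussian c a x * cos (b * (x - a) + t)) =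
  2 * c * \int[mu]_x ((x - a) * (gaussian c a x * sin (b * (x - a) + t))).
Proof.
move=> c0.
have := Rintegral_derive_line (@continuous_dg c a b t)
  (@integrable_dg c a b t _ measurableT c0) (is_derive_gaussian_sin c a b t)
  (cvg_gaussian_sin b t (cvg_gaussian_nat a c0))
  (cvg_gaussian_sin b t (cvg_gaussian_opp_nat a c0)).
rewrite Rintegral_dg// => /eqP; rewrite addrC addr_eq0 => /eqP ->; ring.
Qed.

(** On the half-line the same primitive leaves the boundary value - sin t at 0:
    this inhomogeneous term is what makes the one-sided transform decay only
    like 1 / b. *)
Lemma gaussian_parts_halfline c b t : 0 < c ->
  b * \int[mu]_(x in [set x | 0 <= x]) (gaussian c 0 x * cos (b * (x - 0) + t)) =
  2 * c * \int[mu]_(x in [set x | 0 <= x])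
            ((x - 0) * (gaussian c 0 x * sin (b * (x - 0) + t))) - sin t.
Proof.
move=> c0.
have := Rintegral_derive_halfline (@continuous_dg c 0 b t)
  (@integrable_dg c 0 b t _ measurableT c0) (is_derive_gaussian_sin c 0 b t)
  (cvg_gaussian_sin b t (cvg_gaussian_nat 0 c0)).
rewrite Rintegral_dg//; last by rewrite -set_itvcy; exact: measurable_itv.
rewrite subrr mulr0 add0r /gaussian subrr expr0n/= mulr0 oppr0 expR0 mul1r.
set I := Rintegral _ _ _; set J := Rintegral _ _ _ => h.
by apply: (addrI (- (2 * c) * I)); rewrite h; ring.
Qed.

Lemma is_derive_expR_quadratic c b : 0 < c ->
  is_derive (b : R) 1 (fun b => expR (b ^+ 2 / (4 * c)))
    (b / (2 * c) * expR (b ^+ 2 / (4 * c))).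
Proof.
move=> c0.
have h : is_derive (b : R) 1 (fun b : R => b ^+ 2 / (4 * c)) (b / (2 * c)).
  apply: is_derive_eq; rewrite /GRing.scale/=.
  by field; lra.
have := is_derive1_comp (is_derive_expR _) h.
by rewrite (mulrC (expR _)).
Qed.

(** As a function of b, the integral F satisfies 2 c F' + b F = 0, so
    exp (b^2 / 4c) F is constant, and its value at b = 0 is cos t times
    the Gaussian integral. *)
Lemma fourier_gaussian_cos c a b t : 0 < c ->
  \int[mu]_x (gaussian c a x * cos (b * (x - a) + t)) =
  Num.sqrt (pi / c) * expR (- (b ^+ 2 / (4 * c))) * cos t.
Proof.
move=> c0.
pose F b := \int[mu]_x (gaussian c a x * cos (b * (x - a) + t)).
pose phi b := expR (b ^+ 2 / (4 * c)) * F b.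
have dphi x : is_derive (x : R) (1 : R) phi 0.
  have h1 := is_derive_expR_quadratic x c0.
  have h2 := is_derive_Rintegral_gaussian_cos a t x (@measurableT _ R) c0.
  have h3 := gaussian_parts_line a x t c0.
  apply: is_derive_eq; rewrite /GRing.scale/=.
  rewrite -/(F x) in h3 *; move: h3; set I := Rintegral _ _ _ => h3.
  rewrite (_ : I = x * F x / (2 * c)); last by rewrite h3; field; lra.
  by field; lra.
have := is_derive_0_is_cst b 0 dphi.
rewrite /phi expr0n/= mul0r expR0 mul1r => h.
have F0 : F 0 = Num.sqrt (pi / c) * cos t.
  rewrite /F; under eq_Rintegral do rewrite mul0r add0r.
  rewrite RintegralZr//; last exact: integrable_gaussian.
  by rewrite Rintegral_gaussian.
rewrite -/(F b) expRN mulrAC -F0 -h mulrAC mulfV ?mul1r//.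
by rewrite gt_eqF// expR_gt0.
Qed.

Lemma fourier_gaussian_sin c a b t : 0 < c ->
  \int[mu]_x (gaussian c a x * sin (b * (x - a) + t)) =
  Num.sqrt (pi / c) * expR (- (b ^+ 2 / (4 * c))) * sin t.
Proof.
have sinE x : sin x = cos (x - pi / 2).
  by rewrite cosB cos_pihalf sin_pihalf mulr0 mulr1 add0r.
move=> c0; rewrite sinE -(fourier_gaussian_cos a)//.
by apply: eq_Rintegral => x _; rewrite sinE addrA.
Qed.

Lemma integrable_gaussian_sin c a b t D : measurable D -> 0 < c ->
  mu.-integrable D (EFin \o (fun x => gaussian c a x * sin (b * (x - a) + t))).
Proof.
move=> mD c0; apply: (@integrable_le_gaussian _ c a 1) => //.
  exact: continuous_gaussian_sin.
move=> x; rewrite mul1r normrM gtr0_norm ?gaussian_gt0//.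
by rewrite ler_piMr ?normr_sin_le1// ltW// gaussian_gt0.
Qed.

(** With the phase t = - pi / 2 the cosine is a sine, and the half-line integral
    F satisfies 2 c F' + b F = 1 and F 0 = 0.  Hence exp (b^2 / 4c) F has
    derivative exp (b^2 / 4c) / 2c, which for frequencies up to b0 is at least the
    derivative of exp (b^2 / 4c) / b0; take b0 to be the frequency of the claim.
    The bound is of the true order 1 / b0. *)
Lemma halfline_sin_gaussian_ge c b : 0 < c -> 0 < b ->
  (1 - expR (- (b ^+ 2 / (4 * c)))) / b <=
  \int[mu]_(x in [set x | 0 <= x]) (gaussian c 0 x * sin (b * x)).
Proof.
move=> c0 b0.
have mpos : measurable [set x : R | 0 <= x].
  by rewrite -set_itvcy; exact: measurable_itv.
pose F b := \int[mu]_(x in [set x | 0 <= x])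
  (gaussian c 0 x * cos (b * (x - 0) + - (pi / 2))).
have FE b' : F b' = \int[mu]_(x in [set x | 0 <= x]) (gaussian c 0 x * sin (b' * x)).
  apply: eq_Rintegral => x _; congr (_ * _).
  by rewrite subr0 cosB cos_pihalf sin_pihalf mulr0 mulr1 add0r.
have F0 : F 0 = 0.
  rewrite FE; under eq_Rintegral do rewrite mul0r sin0 mulr0.
  by rewrite Rintegral_cst// mul0r.
(* phi increases on [0, b], and phi 0 <= phi b is the claim times exp (b^2 / 4c). *)
pose phi x := expR (x ^+ 2 / (4 * c)) * F x - expR (x ^+ 2 / (4 * c)) / b.
have dphi x : is_derive (x : R) (1 : R) phi
    (expR (x ^+ 2 / (4 * c)) / (2 * c) * (1 - x / b)).
  have h1 := is_derive_expR_quadratic x c0.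
  have h2 := is_derive_Rintegral_gaussian_cos 0 (- (pi / 2)) x mpos c0.
  have h3 := gaussian_parts_halfline x (- (pi / 2)) c0.
  rewrite sinN sin_pihalf opprK -/(F x) in h3.
  apply: is_derive_eq; rewrite /GRing.scale/= -/(F x).
  move: h3; set Y := Rintegral _ _ _ => h3.
  rewrite (_ : Y = (x * F x - 1) / (2 * c)); last by rewrite h3; field; lra.
  by field; lra.
have : phi 0 <= phi b.
  apply: (@ger0_derive1_ndecr _ phi 0 b) => //.
  - move=> x; rewrite in_itv/= => /andP[x0 xb].
    rewrite derive1E (@derive_val _ _ _ _ _ _ _ (dphi x)); apply: mulr_ge0.
      by rewrite divr_ge0 ?expR_ge0//; lra.
    by rewrite subr_ge0 ler_pdivrMr// mul1r ltW.
  - by apply: continuous_subspaceT; exact: is_derive_continuous dphi.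
  - exact: ltW.
rewrite /phi F0 mulr0 expr0n/= mul0r expR0 add0r mul1r -FE.
set e := expR (b ^+ 2 / (4 * c)) => h.
rewrite expRN -/e.
have e0 : 0 < e by exact: expR_gt0.
rewrite -(ler_pM2l e0).
rewrite (_ : e * _ = (e - 1) / b); last by field; rewrite !gt_eqF.
by rewrite mulrBl mul1r; lra.
Qed.

End fourier.

(** * Integrals of tensor products *)

Section product.
Context d1 d2 (T1 : measurableType d1) (T2 : measurableType d2) (R : realType).
Context (m1 : {sigma_finite_measure set T1 -> \bar R})
  (m2 : {sigma_finite_measure set T2 -> \bar R}).
Implicit Types (f : T1 -> R) (g : T2 -> R).

Lemma integrable_tensor f g : m1.-integrable setT (EFin \o f) ->
  m2.-integrable setT (EFin \o g) ->
  (m1 \x m2)%E.-integrable setT (EFin \o (fun p => f p.1 * g p.2)).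
Proof.
move=> fi gi.
have mf : measurable_fun setT f by apply/measurable_EFinP; exact: measurable_int fi.
have mg : measurable_fun setT g by apply/measurable_EFinP; exact: measurable_int gi.
have mfg : measurable_fun setT (EFin \o (fun p : T1 * T2 => f p.1 * g p.2)).
  apply/measurable_EFinP; apply: measurable_funM.
  - exact: measurableT_comp mf _.
  - exact: measurableT_comp mg _.
apply/integrable12ltyP => //=.
rewrite (_ : (\int[m1]_x _)%E = (\int[m1]_x (`|f x|%:E * \int[m2]_y `|g y|%:E))%E);
    last first.
  apply: eq_integral => x _.
  under eq_integral do rewrite normrM EFinM.
  rewrite ge0_integralZl//.
  by apply/measurable_EFinP; exact: measurableT_comp mg.
have /integrableP[_ foo] := fi; have /integrableP[_ goo] := gi.
have g0 : (0 <= \int[m2]_y `|g y|%:E)%E by apply: integral_ge0.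
rewrite ge0_integralZr//.
- apply: lte_mul_pinfty => //; first by apply: integral_ge0.
  by rewrite ge0_fin_numE//; apply: integral_ge0.
- by apply/measurable_EFinP; exact: measurableT_comp mf.
Qed.

(** Fubini's theorem; the domain X x Y is handled by cutting off each factor. *)
Lemma Rintegral_tensor f g (X : set T1) (Y : set T2) :
  measurable X -> measurable Y -> m1.-integrable setT (EFin \o f) ->
  m2.-integrable setT (EFin \o g) ->
  \int[(m1 \x m2)%E]_(p in X `*` Y) (f p.1 * g p.2) =
  \int[m1]_(x in X) f x * \int[m2]_(y in Y) g y.
Proof.
move=> mX mY fi gi.
have fXi : m1.-integrable setT (EFin \o (f \_ X)).
  rewrite -restrict_EFin; apply/integrable_restrict => //; rewrite setTI.
  exact: integrableS fi.
have gYi : m2.-integrable setT (EFin \o (g \_ Y)).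
  rewrite -restrict_EFin; apply/integrable_restrict => //; rewrite setTI.
  exact: integrableS gi.
rewrite Rintegral_mkcond.
rewrite (_ : _ \_ _ = fun p => (f \_ X) p.1 * (g \_ Y) p.2); last first.
  apply/funext => -[x y]; rewrite !patchE in_setX/=.
  by case: (x \in X); case: (y \in Y); rewrite /= ?mul0r ?mulr0.
rewrite /Rintegral -(integral12_prod_meas1 (integrable_tensor fXi gYi))/=.
under eq_integral => x _.
  rewrite /fubini_F/=.
  under eq_integral do rewrite EFinM.
  rewrite integralZl//.
  rewrite -[X in (_ * X)%E]fineK; last exact: integrable_fin_num gYi.
  over.
rewrite integralZr// -[X in (X * _)%E]fineK; last exact: integrable_fin_num fXi.
rewrite /= -[RHS]/(Rintegral _ _ _ * Rintegral _ _ _).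
by rewrite [in RHS]Rintegral_mkcond [X in _ = _ * X]Rintegral_mkcond.
Qed.

End product.

(** * Wigner distribution and norm of a pair of coherent states *)

Local Open Scope complex_scope.

(** The coherent state, of squared norm 1 / sqrt 2, centred at (s, s) in phase
    space: a Gaussian at position s modulated at frequency s. *)
Definition coherent (R : realType) (s y : R) : R[i] :=
  (gaussian pi s y)%:C * expi (2 * pi * s * y).

Definition coherent_pair (R : realType) (r eps k y : R) : R[i] :=
  k%:C * (coherent r y + eps%:C * coherent (- r) y).

Section coherent.
Context {R : realType}.
Notation mu := (@lebesgue_measure R).
Implicit Types (r s eps k x y z xi : R).

Lemma expiD x y : expi (x + y) = expi x * expi y :> R[i].
Proof. by rewrite /expi cosD sinD; simpc; congr (_ +i* _); ring. Qed.

Lemma conj_expi x : conjc (expi x) = expi (- x) :> R[i].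
Proof. by rewrite /expi cosN sinN. Qed.

Let conjcM (u v : R[i]) : conjc (u * v) = conjc u * conjc v.
Proof. exact: rmorphM. Qed.

Let conjcD (u v : R[i]) : conjc (u + v) = conjc u + conjc v.
Proof. exact: rmorphD. Qed.

Let real_mulc (a b c : R) : a%:C * (b +i* c) = (a * b) +i* (a * c).
Proof. by simpc. Qed.

Lemma gaussianM c a b x :
  gaussian c a x * gaussian c b x =
  expR (- (c / 2 * (a - b) ^+ 2)) * gaussian (2 * c) ((a + b) / 2) x.
Proof. by rewrite /gaussian -!expRD; congr expR; field. Qed.

(** Parallelogram identity: in the variables of the Wigner transform the product
    separates into a function of x, centred at the midpoint of s1 and s2, and a
    function of z. *)
Lemma gaussian_wigner s1 s2 x z :
  gaussian pi s1 (x + z / 2) * gaussian pi s2 (x - z / 2) =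
  gaussian (2 * pi) ((s1 + s2) / 2) x * gaussian (pi / 2) (s1 - s2) z :> R.
Proof. by rewrite /gaussian -!expRD; congr expR; field. Qed.

(** The phase is affine in z and is written with z - (s1 - s2), the variable
    centred at the Gaussian factor, as the Fourier transform formula expects;
    the remaining constant is the phase of the interference term. *)
Lemma coherent_wigner_integrand s1 s2 x xi z :
  expi (- (2 * pi * z * xi)) * coherent s1 (x + z / 2) *
    conjc (coherent s2 (x - z / 2)) =
  (gaussian (2 * pi) ((s1 + s2) / 2) x * gaussian (pi / 2) (s1 - s2) z)%:C *
  expi (2 * pi * ((s1 + s2) / 2 - xi) * (z - (s1 - s2)) +
        2 * pi * (s1 - s2) * (x + (s1 + s2) / 2 - xi)).
Proof.
rewrite /coherent conjcM conj_expi conjc_real -gaussian_wigner.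
rewrite [X in _ = _ * expi X](_ : _ = - (2 * pi * z * xi) + 2 * pi * s1 * (x + z / 2) +
   - (2 * pi * s2 * (x - z / 2))); last by field.
rewrite !expiD rmorphM; ring.
Qed.

Let amp s1 s2 x := gaussian (2 * pi) ((s1 + s2) / 2) x : R.
Let phase s1 s2 x xi := 2 * pi * (s1 - s2) * (x + (s1 + s2) / 2 - xi).
Let osc (f : R -> R) s1 s2 x xi z := gaussian (pi / 2) (s1 - s2) z *
  f (2 * pi * ((s1 + s2) / 2 - xi) * (z - (s1 - s2)) + phase s1 s2 x xi).

Lemma coherent_pair_wigner_integrand r eps k x xi z :
  expi (- (2 * pi * z * xi)) * coherent_pair r eps k (x + z / 2) *
    conjc (coherent_pair r eps k (x - z / 2)) =
  (k ^+ 2 * amp r r x * osc cos r r x xi z +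
   (k ^+ 2 * eps ^+ 2 * amp (- r) (- r) x * osc cos (- r) (- r) x xi z +
   (k ^+ 2 * eps * amp r (- r) x * osc cos r (- r) x xi z +
    k ^+ 2 * eps * amp (- r) r x * osc cos (- r) r x xi z))) +i*
  (k ^+ 2 * amp r r x * osc sin r r x xi z +
   (k ^+ 2 * eps ^+ 2 * amp (- r) (- r) x * osc sin (- r) (- r) x xi z +
   (k ^+ 2 * eps * amp r (- r) x * osc sin r (- r) x xi z +
    k ^+ 2 * eps * amp (- r) r x * osc sin (- r) r x xi z))).
Proof.
pose E s1 s2 := expi (- (2 * pi * z * xi)) * coherent s1 (x + z / 2) *
    conjc (coherent s2 (x - z / 2)).
transitivity (k%:C * k%:C * (E r r + (eps%:C * eps%:C * E (- r) (- r) +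
    (eps%:C * E r (- r) + eps%:C * E (- r) r)))).
  by rewrite /coherent_pair /E !(conjcM, conjcD) !conjc_real; ring.
have EE s1 s2 : E s1 s2 = (amp s1 s2 x * osc cos s1 s2 x xi z) +i*
                          (amp s1 s2 x * osc sin s1 s2 x xi z).
  rewrite /E coherent_wigner_integrand /expi real_mulc.
  by rewrite /amp /osc /phase !mulrA.
rewrite !EE -!rmorphM !real_mulc.
apply/eqP; rewrite eq_complex [complex.Re _]/= [complex.Im _]/=.
by apply/andP; split; apply/eqP; rewrite /=; ring.
Qed.

Let Rintegral4 (a b c d : R) (f1 f2 f3 f4 : R -> R) :
  mu.-integrable setT (EFin \o f1) -> mu.-integrable setT (EFin \o f2) ->
  mu.-integrable setT (EFin \o f3) -> mu.-integrable setT (EFin \o f4) ->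
  \int[mu]_x (a * f1 x + (b * f2 x + (c * f3 x + d * f4 x))) =
  a * \int[mu]_x f1 x + (b * \int[mu]_x f2 x +
    (c * \int[mu]_x f3 x + d * \int[mu]_x f4 x)).
Proof.
move=> i1 i2 i3 i4.
have j1 := integrable_EFinZl a measurableT i1.
have j2 := integrable_EFinZl b measurableT i2.
have j3 := integrable_EFinZl c measurableT i3.
have j4 := integrable_EFinZl d measurableT i4.
have j34 := integrable_EFinD measurableT j3 j4.
have j234 := integrable_EFinD measurableT j2 j34.
by rewrite !RintegralD// !RintegralZl.
Qed.

Let pi2_gt0 : 0 < pi / 2 :> R. Proof. by rewrite divr_gt0// pi_gt0. Qed.

Let expR_osc s1 s2 xi :
  expR (- ((2 * pi * ((s1 + s2) / 2 - xi)) ^+ 2 / (4 * (pi / 2)))) =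
  gaussian (2 * pi) ((s1 + s2) / 2) xi :> R.
Proof.
rewrite /gaussian; congr (expR (- _)).
by have := @pi_gt0 R; move=> ?; field; lra.
Qed.

Let sqrt_pi2 : pi / (pi / 2) = 2 :> R.
Proof. by have := @pi_gt0 R; move=> ?; field; lra. Qed.

Let Rintegral_osc_cos s1 s2 x xi :
  \int[mu]_z osc cos s1 s2 x xi z =
  Num.sqrt 2 * amp s1 s2 xi * cos (phase s1 s2 x xi).
Proof. by rewrite /osc fourier_gaussian_cos// expR_osc sqrt_pi2. Qed.

Let Rintegral_osc_sin s1 s2 x xi :
  \int[mu]_z osc sin s1 s2 x xi z =
  Num.sqrt 2 * amp s1 s2 xi * sin (phase s1 s2 x xi).
Proof. by rewrite /osc fourier_gaussian_sin// expR_osc sqrt_pi2. Qed.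

Let integrable_osc_cos s1 s2 x xi :
  mu.-integrable setT (EFin \o osc cos s1 s2 x xi).
Proof. exact: integrable_gaussian_cos. Qed.

Let integrable_osc_sin s1 s2 x xi :
  mu.-integrable setT (EFin \o osc sin s1 s2 x xi).
Proof. exact: integrable_gaussian_sin. Qed.

(** The interference term centred at the origin oscillates as
    cos (4 pi r (x - xi)); expanding this cosine makes it the sum of the tensor
    squares of [wave cos r] and [wave sin r]. *)
Definition wave (f : R -> R) r x := gaussian (2 * pi) 0 x * f (4 * pi * r * x).

(** The imaginary parts cancel: the diagonal phases are 0 and the two
    interference phases are opposite.  What remains is a combination of
    tensor squares h(x) h(xi), with nonnegative coefficients when eps >= 0. *)
Lemma wigner_coherent_pair r eps k (p : R * R) :
  wigner (coherent_pair r eps k) (coherent_pair r eps k) p =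
  (k ^+ 2 * Num.sqrt 2 *
    (gaussian (2 * pi) r p.1 * gaussian (2 * pi) r p.2 +
     (eps ^+ 2 * (gaussian (2 * pi) (- r) p.1 * gaussian (2 * pi) (- r) p.2) +
     (2 * eps * (wave cos r p.1 * wave cos r p.2) +
      2 * eps * (wave sin r p.1 * wave sin r p.2)))))%:C.
Proof.
rewrite /wigner /Cintegral; set x := p.1; set xi := p.2.
under eq_Rintegral do rewrite coherent_pair_wigner_integrand/=.
rewrite Rintegral4 ?Rintegral_osc_cos//.
under [in X in _ +i* X]eq_Rintegral do rewrite coherent_pair_wigner_integrand/=.
rewrite Rintegral4 ?Rintegral_osc_sin//.
have m1 : (r + r) / 2 = r :> R by field.
have m2 : (- r + - r) / 2 = - r :> R by field.
have d1 : phase r (- r) x xi = 4 * pi * r * x - 4 * pi * r * xi.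
  by rewrite /phase; field.
have d2 : phase (- r) r x xi = - (4 * pi * r * x - 4 * pi * r * xi).
  by rewrite /phase; field.
have d3 s : phase s s x xi = 0 by rewrite /phase subrr mulr0 mul0r.
rewrite d1 d2 !d3 /amp m1 m2 subrr mul0r addNr mul0r !cosN !sinN cos0 sin0.
by congr (_ +i* _); rewrite ?cosB /wave; ring.
Qed.

Lemma sqr_normc_coherent_pair r eps k y :
  Normc.normc (coherent_pair r eps k y) ^+ 2 =
  k ^+ 2 * gaussian (2 * pi) r y +
   (k ^+ 2 * eps ^+ 2 * gaussian (2 * pi) (- r) y +
    2 * k ^+ 2 * eps * expR (- (2 * pi * r ^+ 2)) * wave cos r y).
Proof.
have E1 := gaussianM pi r r y; have E2 := gaussianM pi (- r) (- r) y.
have E3 := gaussianM pi r (- r) y.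
move: E1 E2 E3; rewrite !subrr expr0n/= mulr0 oppr0 expR0 !mul1r mul0r.
rewrite (_ : (r + r) / 2 = r); last by field.
rewrite (_ : (- r + - r) / 2 = - r); last by field.
rewrite (_ : pi / 2 * (r - - r) ^+ 2 = 2 * pi * r ^+ 2); last by field.
move=> <- <- E3.
rewrite /wave [X in _ = _ + (_ + X)](_ : _ = 2 * k ^+ 2 * eps *
  (expR (- (2 * pi * r ^+ 2)) * gaussian (2 * pi) 0 y) * cos (4 * pi * r * y));
  last by ring.
rewrite -E3.
rewrite /coherent_pair /coherent /expi; simpc.
rewrite sqr_sqrtr ?addr_ge0 ?sqr_ge0//.
rewrite cosN sinN.
rewrite (_ : 4 * pi * r * y = 2 * pi * r * y + 2 * pi * r * y); last by ring.
rewrite cosD.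
have := cos2Dsin2 (2 * pi * r * y).
set A := gaussian _ _ _; set B := gaussian _ _ _.
set c := cos _; set s := sin _ => h.
(* cos (2 t) is written c^2 - s^2, so only c^2 + s^2 = 1 is left to use. *)
transitivity (k ^+ 2 * ((A ^+ 2 + eps ^+ 2 * B ^+ 2) * (c ^+ 2 + s ^+ 2) +
  2 * eps * A * B * (c ^+ 2 - s ^+ 2))); first by ring.
by rewrite h; ring.
Qed.

Lemma integrable_wave_cos r : mu.-integrable setT (EFin \o wave cos r).
Proof.
have := @integrable_gaussian_cos R (2 * pi) 0 (4 * pi * r) 0 _ measurableT.
under eq_fun do rewrite subr0 addr0.
by apply; rewrite mulr_gt0// pi_gt0.
Qed.

Lemma integrable_wave_sin r : mu.-integrable setT (EFin \o wave sin r).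
Proof.
have := @integrable_gaussian_sin R (2 * pi) 0 (4 * pi * r) 0 _ measurableT.
under eq_fun do rewrite subr0 addr0.
by apply; rewrite mulr_gt0// pi_gt0.
Qed.

Lemma Rintegral_wave_cos r :
  \int[mu]_x wave cos r x = Num.sqrt 2^-1 * expR (- (2 * pi * r ^+ 2)).
Proof.
have p0 : (0 : R) < 2 * pi by rewrite mulr_gt0// pi_gt0.
have := fourier_gaussian_cos 0 (4 * pi * r) 0 p0.
under eq_Rintegral do rewrite subr0 addr0.
move=> ->; rewrite cos0 mulr1 invfM mulrCA mulfV ?gt_eqF ?pi_gt0// mulr1.
congr (_ * expR (- _)).
by have := @pi_gt0 R; move=> ?; field; lra.
Qed.

(** The squared L2 norm of [coherent_pair r eps 1]: the two states overlap only
    by a multiple of exp (- 4 pi r^2). *)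
Definition sqr_norm r eps :=
  Num.sqrt 2^-1 * (1 + eps ^+ 2 + 2 * eps * expR (- (2 * pi * r ^+ 2)) ^+ 2).

Lemma Rintegral_sqr_normc_coherent_pair r eps k :
  \int[mu]_y Normc.normc (coherent_pair r eps k y) ^+ 2 = k ^+ 2 * sqr_norm r eps.
Proof.
have p0 : (0 : R) < 2 * pi by rewrite mulr_gt0// pi_gt0.
have i1 s := @integrable_gaussian R (2 * pi) s p0.
have i2 := integrable_wave_cos r.
have v s : \int[mu]_x gaussian (2 * pi) s x = Num.sqrt 2^-1.
  by rewrite Rintegral_gaussian// invfM mulrCA mulfV ?mulr1// gt_eqF// pi_gt0.
under eq_Rintegral do rewrite sqr_normc_coherent_pair.
rewrite !RintegralD//; repeat apply: integrable_EFinD => //;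
  try exact: integrable_EFinZl.
rewrite !RintegralZl// !v Rintegral_wave_cos /sqr_norm.
by ring.
Qed.

Lemma sqr_norm_gt0 r eps : 0 <= eps -> 0 < sqr_norm r eps.
Proof.
move=> e0; apply: mulr_gt0; first by rewrite sqrtr_gt0.
rewrite -addrA ltr_pwDl// addr_ge0 ?sqr_ge0// mulr_ge0 ?sqr_ge0//.
by rewrite mulr_ge0.
Qed.

Lemma cL2norm_eq1 (u : R -> R[i]) :
  (\int[mu]_y (Normc.normc (u y) ^+ 2)%:E = 1)%E -> cL2norm u = 1%E.
Proof.
have n0 y : 0 <= Normc.normc (u y) by case: (u y) => a b; exact: sqrtr_ge0.
rewrite /cL2norm unlock => h.
rewrite (_ : (\int[mu]_x _)%E = 1%E) ?poweR1r// -h.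
apply: eq_integral => y _.
by rewrite [X in (X `^ _)%E]/= poweR_EFin ger0_norm// powR_mulrn.
Qed.

Lemma cL2norm_coherent_pair r eps : 0 <= eps ->
  cL2norm (coherent_pair r eps (Num.sqrt (sqr_norm r eps))^-1) = 1%E.
Proof.
move=> e0; set k := _^-1.
have N0 := sqr_norm_gt0 r e0.
have : (\int[mu]_y (Normc.normc (coherent_pair r eps k y) ^+ 2)%:E = 1)%E.
  have fi : mu.-integrable setT
      (EFin \o (fun y => Normc.normc (coherent_pair r eps k y) ^+ 2)).
    have p0 : (0 : R) < 2 * pi by rewrite mulr_gt0// pi_gt0.
    rewrite (funext (sqr_normc_coherent_pair r eps k)).
    apply: integrable_EFinD => //.
      by apply: integrable_EFinZl => //; exact: integrable_gaussian.
    apply: integrable_EFinD => //; apply: integrable_EFinZl => //.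
      exact: integrable_gaussian.
    exact: integrable_wave_cos.
  rewrite -[LHS]fineK; last exact: integrable_fin_num.
  congr EFin; rewrite -[LHS]/(Rintegral _ _ _) Rintegral_sqr_normc_coherent_pair.
  by rewrite /k exprVn sqr_sqrtr ?mulVf ?gt_eqF// ltW.
exact: cL2norm_eq1.
Qed.

End coherent.

(** * Integrals over the quadrant and over squares *)

Section quadrant.
Context {R : realType}.
Notation mu := (@lebesgue_measure R).
Implicit Types (r eps k : R) (X : set R).

Let p0 : (0 : R) < 2 * pi. Proof. by rewrite mulr_gt0// pi_gt0. Qed.

(** The real value of the Wigner distribution given by [wigner_coherent_pair]. *)
Definition wigner_pair r eps k (p : R * R) : R :=
  k ^+ 2 * Num.sqrt 2 *
    (gaussian (2 * pi) r p.1 * gaussian (2 * pi) r p.2 +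
     (eps ^+ 2 * (gaussian (2 * pi) (- r) p.1 * gaussian (2 * pi) (- r) p.2) +
     (2 * eps * (wave cos r p.1 * wave cos r p.2) +
      2 * eps * (wave sin r p.1 * wave sin r p.2)))).

Lemma Cintegral_wigner_pair r eps k (D : set (R * R)) :
  Cintegral (mu \x mu)%E D
    (wigner (coherent_pair r eps k) (coherent_pair r eps k)) =
  (\int[(mu \x mu)%E]_(p in D) wigner_pair r eps k p)%:C.
Proof.
rewrite /Cintegral; under eq_Rintegral do rewrite wigner_coherent_pair.
under [in X in _ +i* X]eq_Rintegral do rewrite wigner_coherent_pair/=.
by rewrite /= /Rintegral integral0.
Qed.

Lemma integrable_wigner_pair r eps k :
  (mu \x mu)%E.-integrable setT (EFin \o wigner_pair r eps k).
Proof.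
have ig s := integrable_gaussian s p0.
have ic := integrable_wave_cos r; have is' := integrable_wave_sin r.
apply: integrable_EFinZl => //; apply: integrable_EFinD => //.
  exact: integrable_tensor.
apply: integrable_EFinD => //.
  by apply: integrable_EFinZl => //; exact: integrable_tensor.
by apply: integrable_EFinD => //; apply: integrable_EFinZl => //;
  exact: integrable_tensor.
Qed.

(** On a product X x X each tensor square integrates to the square of a
    one-dimensional integral, so for eps >= 0 every term is nonnegative and
    lower bounds on single factors are enough. *)
Lemma Rintegral_wigner_pair r eps k X : measurable X ->
  \int[(mu \x mu)%E]_(p in X `*` X) wigner_pair r eps k p =
  k ^+ 2 * Num.sqrt 2 *
    ((\int[mu]_(x in X) gaussian (2 * pi) r x) ^+ 2 +
     (eps ^+ 2 * (\int[mu]_(x in X) gaussian (2 * pi) (- r) x) ^+ 2 +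
     (2 * eps * (\int[mu]_(x in X) wave cos r x) ^+ 2 +
      2 * eps * (\int[mu]_(x in X) wave sin r x) ^+ 2))).
Proof.
move=> mX.
have mXX : measurable (X `*` X) by exact: measurableX.
have ig s := integrable_gaussian s p0.
have ic := integrable_wave_cos r; have is' := integrable_wave_sin r.
have sub f : mu.-integrable setT (EFin \o f) ->
    (mu \x mu)%E.-integrable (X `*` X) (EFin \o (fun p => f p.1 * f p.2)).
  by move=> fi; apply: integrableS (integrable_tensor fi fi).
have t1 := sub _ (ig r); have t2 := sub _ (ig (- r)).
have t3 := sub _ ic; have t4 := sub _ is'.
have Z c f : (mu \x mu)%E.-integrable (X `*` X) (EFin \o f) ->
    (mu \x mu)%E.-integrable (X `*` X) (EFin \o (fun p => c * f p)).
  by move=> fi; apply: integrable_EFinZl.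
have A f g : (mu \x mu)%E.-integrable (X `*` X) (EFin \o f) ->
    (mu \x mu)%E.-integrable (X `*` X) (EFin \o g) ->
    (mu \x mu)%E.-integrable (X `*` X) (EFin \o (fun p => f p + g p)).
  by move=> fi gi; apply: integrable_EFinD.
have s34 := A _ _ (Z (2 * eps) _ t3) (Z (2 * eps) _ t4).
have s234 := A _ _ (Z (eps ^+ 2) _ t2) s34.
have s1234 := A _ _ t1 s234.
have s2 := Z (eps ^+ 2) _ t2; have s3 := Z (2 * eps) _ t3.
have s4 := Z (2 * eps) _ t4.
rewrite /wigner_pair RintegralZl// !RintegralD// !RintegralZl//.
by rewrite !Rintegral_tensor// !expr2.
Qed.

Let measurable_halfline : measurable [set x : R | 0 <= x].
Proof. by rewrite -set_itvcy; exact: measurable_itv. Qed.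

(** For x < 0 <= r one has (x - r)^2 >= x^2 + r^2, so the part of the Gaussian
    lost on the left is at most exp (- 2 pi r^2) times a full Gaussian. *)
Lemma halfline_gaussian_ge r : 0 <= r ->
  Num.sqrt 2^-1 * (1 - expR (- (2 * pi * r ^+ 2))) <=
  \int[mu]_(x in [set x | 0 <= x]) gaussian (2 * pi) r x.
Proof.
move=> r0.
have v s : \int[mu]_x gaussian (2 * pi) s x = Num.sqrt 2^-1.
  by rewrite Rintegral_gaussian// invfM mulrCA mulfV ?mulr1// gt_eqF// pi_gt0.
have i1 : mu.-integrable setT
    (EFin \o (gaussian (2 * pi) r \_ [set x | 0 <= x])).
  rewrite -restrict_EFin; apply/integrable_restrict => //; rewrite setTI.
  by apply: integrableS (integrable_gaussian r p0).
have i2 := integrable_EFinZl (expR (- (2 * pi * r ^+ 2))) measurableT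
  (integrable_gaussian 0 p0).
have i3 := integrable_EFinD measurableT i1 i2.
have := le_Rintegral measurableT (integrable_gaussian r p0) i3.
rewrite RintegralD// RintegralZl//; last exact: integrable_gaussian.
rewrite !v -Rintegral_mkcond => h.
rewrite mulrBr mulr1 lerBlDr [X in _ <= _ + X]mulrC; apply: h => x _.
rewrite patchE; case: ifPn => [_|].
  by rewrite lerDl mulr_ge0 ?expR_ge0// ltW// gaussian_gt0.
rewrite notin_setE/= => /negP; rewrite -ltNge => x0.
rewrite add0r /gaussian -expRD ler_expR -subr_ge0.
rewrite [X in 0 <= X](_ : _ = - (4 * pi * r * x)); last by ring.
by rewrite oppr_ge0 mulr_ge0_le0 ?(ltW x0)// mulr_ge0// mulr_ge0// pi_ge0.
Qed.

Lemma halfline_wave_sin_ge r : 0 < r ->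
  (1 - expR (- (2 * pi * r ^+ 2))) / (4 * pi * r) <=
  \int[mu]_(x in [set x | 0 <= x]) wave sin r x.
Proof.
move=> r0; have pi0 := @pi_gt0 R.
rewrite (_ : 2 * pi * r ^+ 2 = (4 * pi * r) ^+ 2 / (4 * (2 * pi))).
  by apply: halfline_sin_gaussian_ge => //; rewrite !mulr_gt0.
by field; lra.
Qed.

(** Numerical input for r = 3, from pi >= 2 and exp 1 >= 2. *)
Lemma expR_18pi_le : expR (- (2 * pi * 3 ^+ 2)) <= 100^-1 ^+ 4 :> R.
Proof.
have e1 : 2 <= expR 1 :> R by have := expR_ge1Dx (1 : R).
have e7 : expR (- 7%:R) <= 100^-1 :> R.
  rewrite expRN lef_pV2 ?posrE ?expR_gt0//.
  rewrite -[7%:R]mulr1 expRM_natl.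
  apply: le_trans (_ : 2 ^+ 7 <= _); last by rewrite lerXn2r ?nnegrE ?expR_ge0.
  by rewrite -natrX ler_nat.
apply: le_trans (_ : expR (- 7%:R) ^+ 4 <= _); last first.
  by rewrite lerXn2r ?nnegrE ?expR_ge0.
by rewrite -expRM_natl ler_expR; have := @pi_ge2 R; lra.
Qed.

(** Put q = exp (- 2 pi r^2), and let T and S be the half-line integrals of the
    Gaussian at r and of [wave sin r].  The claim follows from
    1 + eps^2 + 2 eps q^2 < 2 T^2 + 4 eps S^2, where 2 T^2 >= (1 - q)^2.  With
    r = 3 and pi < 4 the lower bound on S is at least 1/49, so the gain
    4 eps S^2 - eps^2 is positive for eps = 1/2500 and of order 10^-7, whereas q
    is at most 10^-8. *)
Lemma quadrant_wigner_pair_gt1 r eps : r = 3 -> eps = 50^-1 ^+ 2 ->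
  1 < \int[(mu \x mu)%E]_(p in [set x | 0 <= x] `*` [set x | 0 <= x])
        wigner_pair r eps (Num.sqrt (sqr_norm r eps))^-1 p.
Proof.
move=> r3 epsE.
have eps0 : 0 <= eps by rewrite epsE sqr_ge0.
have r0 : 0 < r by rewrite r3.
rewrite Rintegral_wigner_pair// exprVn sqr_sqrtr; last exact/ltW/sqr_norm_gt0.
have N0 := sqr_norm_gt0 r eps0.
(* k^2 is the inverse of the squared norm: clear it. *)
rewrite -mulrA -ltr_pdivrMl ?invr_gt0// invrK mulr1.
have h0 : 0 < Num.sqrt 2^-1 :> R by rewrite sqrtr_gt0.
have hh : Num.sqrt 2^-1 ^+ 2 = 2^-1 :> R by rewrite sqr_sqrtr.
have -> : Num.sqrt 2 = 2 * Num.sqrt 2^-1 :> R.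
  rewrite sqrtrV//; apply: (@mulIf _ (Num.sqrt 2)); first by rewrite gt_eqF// sqrtr_gt0.
  by rewrite -expr2 sqr_sqrtr// mulfVK// gt_eqF// sqrtr_gt0.
have := halfline_gaussian_ge (ltW r0); have := halfline_wave_sin_ge r0.
rewrite /sqr_norm r3.
have := expR_18pi_le; have := expR_ge0 (- (2 * pi * 3 ^+ 2) : R).
set q := expR _; set S := Rintegral _ _ _; set T := Rintegral _ _ _.
set T' := Rintegral _ _ _; set C := Rintegral _ _ _.
set h := Num.sqrt 2^-1 in h0 hh *.
move=> q0 q1 hS hT.
have S1 : 49^-1 <= S.
  apply: le_trans hS.
  have pi0 := @pi_gt0 R; have pi4 : pi < 4 :> R by have := @pihalf_lt2 R; lra.
  rewrite ler_pdivlMr; last by lra.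
  by lra.
rewrite (mulrC 2 h) -(mulrA h) ltr_pM2l//.
have T2 : (1 - q) ^+ 2 / 2 <= T ^+ 2.
  rewrite -hh -exprMn mulrC lerXn2r ?nnegrE//; first by rewrite mulr_ge0 ?ltW//; lra.
  by apply: le_trans hT; rewrite mulr_ge0 ?ltW//; lra.
have S2 : 49^-1 ^+ 2 <= S ^+ 2.
  by rewrite lerXn2r ?nnegrE//; lra.
have C2 := sqr_ge0 C; have T'2 : 0 <= eps ^+ 2 * T' ^+ 2 by rewrite mulr_ge0 ?sqr_ge0.
have q2 : q ^+ 2 <= q by rewrite expr2 ler_piMr//; lra.
have q2' := sqr_ge0 q.
have T2' : 1 - 2 * q <= 2 * T ^+ 2.
  by move: T2; rewrite sqrrB; lra.
move: (T ^+ 2) (S ^+ 2) (C ^+ 2) (q ^+ 2) (eps ^+ 2 * T' ^+ 2) T2' S2 C2 q2 q2' T'2.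
by rewrite epsE => x1 x2 x3 x4 x5; lra.
Qed.

Lemma square_wigner_pair_gt1 (f : R * R -> R) :
  (mu \x mu)%E.-integrable setT (EFin \o f) ->
  1 < \int[(mu \x mu)%E]_(p in [set x | 0 <= x] `*` [set x | 0 <= x]) f p ->
  exists2 a : R, 0 < a &
  1 < \int[(mu \x mu)%E]_(p in [set x | 0 <= x <= a] `*` [set x | 0 <= x <= a]) f p.
Proof.
move=> fi f1.
have mE (a : R) : measurable [set x : R | 0 <= x <= a].
  by rewrite -set_itvcc; exact: measurable_itv.
have : \int[(mu \x mu)%E]_(p in [set x | 0 <= x <= n%:R] `*` [set x | 0 <= x <= n%:R]) f p
    @[n --> \oo] -->
    \int[(mu \x mu)%E]_(p in [set x | 0 <= x] `*` [set x | 0 <= x]) f p.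
  apply: cvg_Rintegral_exhaust.
  - exact: measurableX.
  - by move=> n; apply: measurableX; exact: mE.
  - by move=> n [x y] [/= /andP[? _] /andP[? _]].
  - move=> [x y] [/= x0 y0]; near=> n; split => /=; apply/andP; split => //.
    + by near: n; exact: nbhs_infty_ger.
    + by near: n; exact: nbhs_infty_ger.
  - by apply: integrableS fi => //; exact: measurableX.
move=> /cvgr_gt /(_ _ f1) h.
near \oo => n; exists n%:R.
  by near: n; exact: nbhs_infty_gtr.
by near: n.
Unshelve. all: by end_near. Qed.

End quadrant.

(** * Smoothness and rapid decay *)

Definition gauss_trig (R : realType) (a b : R) (p q : {poly R}) (y : R) : R :=
  gaussian pi a y * (p.[y] * cos (b * y) + q.[y] * sin (b * y)).

(** The class containing the real and imaginary parts of the state and closed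
    under differentiation, in which rapid decay is visible. *)
Inductive gauss_trig_span (R : realType) : (R -> R) -> Prop :=
| gauss_trig_span_gen a b p q : gauss_trig_span (gauss_trig a b p q)
| gauss_trig_span_add f g : gauss_trig_span f -> gauss_trig_span g ->
    gauss_trig_span (fun y => f y + g y).

Section schwartz.
Context {R : realType}.
Implicit Types (a b y : R) (p q : {poly R}) (f : R -> R).

Lemma is_derive_gauss_trig a b p q y :
  is_derive (y : R) 1 (gauss_trig a b p q)
    (gauss_trig a b (p^`() - (2 * pi) *: (('X - a%:P) * p) + b *: q)
                    (q^`() - (2 * pi) *: (('X - a%:P) * q) - b *: p) y).
Proof.
have hg := is_derive_gaussian pi a y.
have hc := is_derive_cos_affine b 0 y; have hs := is_derive_sin_affine b 0 y.
have hp := is_derive_poly p y; have hq := is_derive_poly q y.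
rewrite (_ : gauss_trig a b p q = fun y => gaussian pi a y *
  (p.[y] * cos (b * y + 0) + q.[y] * sin (b * y + 0))); last first.
  by apply/funext => z; rewrite addr0.
apply: is_derive_eq; rewrite /gauss_trig /GRing.scale/= 
  !(hornerD, hornerN, hornerZ, hornerM, hornerX, hornerC) addr0; ring.
Qed.

Lemma gauss_trig_span_derive f : gauss_trig_span f ->
  exists2 df, gauss_trig_span df & forall y : R, is_derive (y : R) 1 f (df y).
Proof.
elim=> {f} [a b p q|f g _ [df sdf hf] _ [dg sdg hg]].
  by eexists; last exact: is_derive_gauss_trig; exact: gauss_trig_span_gen.
exists (fun y => df y + dg y); first exact: gauss_trig_span_add.
by move=> y; have := hf y; have := hg y => ? ?; apply: is_derive_eq.
Qed.

Lemma gauss_trig_span_derive1n f n : gauss_trig_span f ->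
  gauss_trig_span (derive1n n f).
Proof.
move=> sf; elim: n => [|n /gauss_trig_span_derive[df sdf h]]; first by rewrite derive1n0.
rewrite derive1nS (_ : derive1 _ = df)//.
by apply/funext => y; rewrite derive1E (@derive_val _ _ _ _ _ _ _ (h y)).
Qed.

(** |y|^k <= k! exp |y|, and a Gaussian absorbs the exponential. *)
Lemma monomial_gaussian_bounded (k : nat) a :
  exists M, forall y, `|y| ^+ k * gaussian pi a y <= M.
Proof.
exists (k`!%:R * expR (`|a| + 1)) => y.
have h : `|y| ^+ k <= k`!%:R * expR `|y|.
  case: k => [|k].
    rewrite expr0 fact0 mul1r -expR0 ler_expR//.
  have := expR_ge1Dxn k (normr_ge0 y).
  rewrite -ler_pdivrMl ?ltr0n ?fact_gt0// mulrC => h1.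
  by apply: le_trans h1; rewrite lerDr.
apply: le_trans (ler_wpM2r _ h) _; first exact/ltW/gaussian_gt0.
rewrite -mulrA ler_pM2l ?ltr0n ?fact_gt0// /gaussian -expRD ler_expR.
have tri : `|y| <= `|y - a| + `|a| by rewrite -{1}(subrK a y) ler_normD.
rewrite -(real_normK (num_real (y - a))).
set s := `|y - a| in tri *.
have s2 : s ^+ 2 <= pi * s ^+ 2.
  by rewrite ler_peMl ?sqr_ge0//; have := @pi_ge2 R; lra.
have := sqr_ge0 (s - 1); rewrite sqrrB1 => s1.
have s0 : 0 <= s by exact: normr_ge0.
have : s <= s ^+ 2 + 1 by lra.
by lra.
Qed.

Lemma poly_gaussian_bounded p (k : nat) a :
  exists M, forall y, `|y| ^+ k * (`|p.[y]| * gaussian pi a y) <= M.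
Proof.
elim/poly_ind: p k => [k|p c IH k].
  by exists 0 => y; rewrite horner0 normr0 mul0r mulr0.
have [M1 h1] := IH k.+1; have [M2 h2] := monomial_gaussian_bounded k a.
exists (M1 + `|c| * M2) => y; rewrite hornerMXaddC.
have g0 := ltW (gaussian_gt0 pi a y).
have k0 : 0 <= `|y| ^+ k by rewrite exprn_ge0.
apply: le_trans (_ : `|y| ^+ k * ((`|p.[y]| * `|y| + `|c|) * gaussian pi a y) <= _).
  rewrite ler_wpM2l// ler_wpM2r//.
  by rewrite (le_trans (ler_normD _ _))// normrM.
rewrite (_ : _ * _ = `|y| ^+ k.+1 * (`|p.[y]| * gaussian pi a y) +
  `|c| * (`|y| ^+ k * gaussian pi a y)); last by rewrite exprS; ring.
by rewrite lerD// ler_wpM2l.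
Qed.

Lemma gauss_trig_span_rapid f (k : nat) : gauss_trig_span f ->
  exists M, forall y, `|y| ^+ k * `|f y| <= M.
Proof.
elim=> {f} [a b p q|f g _ [M1 h1] _ [M2 h2]].
  have [M1 h1] := poly_gaussian_bounded p k a.
  have [M2 h2] := poly_gaussian_bounded q k a.
  exists (M1 + M2) => y.
  apply: le_trans (lerD (h1 y) (h2 y)).
  rewrite -mulrDr ler_wpM2l ?exprn_ge0// -mulrDl /gauss_trig normrM.
  rewrite gtr0_norm ?gaussian_gt0// mulrC ler_pM2r ?gaussian_gt0//.
  rewrite (le_trans (ler_normD _ _))// !normrM lerD// ler_piMr//.
  - exact: normr_cos_le1.
  - exact: normr_sin_le1.
exists (M1 + M2) => y; apply: le_trans (lerD (h1 y) (h2 y)).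
by rewrite -mulrDr ler_wpM2l ?exprn_ge0// ler_normD.
Qed.

Lemma normc_le (x y : R) : Normc.normc (x +i* y) <= `|x| + `|y|.
Proof.
rewrite /= -[leRHS]ger0_norm ?addr_ge0// -sqrtr_sqr ler_wsqrtr//.
rewrite sqrrD -!normrX (ger0_norm (sqr_ge0 x)) (ger0_norm (sqr_ge0 y)).
by rewrite addrAC lerDl mulrn_wge0// mulr_ge0.
Qed.

(** All derivatives stay in the class, so its pointwise decay bounds hold for
    each of them. *)
Lemma gauss_trig_span_schwartz (u : R -> R[i]) :
  gauss_trig_span (fun y => complex.Re (u y)) ->
  gauss_trig_span (fun y => complex.Im (u y)) -> schwartz u.
Proof.
move=> sr si; split=> [n y|k n].
  have [dr _ hr] := gauss_trig_span_derive (gauss_trig_span_derive1n n sr).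
  have [di _ hi] := gauss_trig_span_derive (gauss_trig_span_derive1n n si).
  by split; [case: (hr y)|case: (hi y)].
have [M1 h1] := gauss_trig_span_rapid k (gauss_trig_span_derive1n n sr).
have [M2 h2] := gauss_trig_span_rapid k (gauss_trig_span_derive1n n si).
exists (M1 + M2) => y; apply: le_trans (lerD (h1 y) (h2 y)).
by rewrite -mulrDr ler_wpM2l ?exprn_ge0//; exact: normc_le.
Qed.

Lemma schwartz_coherent_pair (r eps k : R) : schwartz (coherent_pair r eps k).
Proof.
apply: gauss_trig_span_schwartz.
  rewrite (_ : (fun y => _) = fun y => gauss_trig r (2 * pi * r) k%:P 0 y +
    gauss_trig (- r) (2 * pi * - r) (k * eps)%:P 0 y).
    by apply: gauss_trig_span_add; exact: gauss_trig_span_gen.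
  by apply/funext => y; rewrite /coherent_pair /coherent /expi /gauss_trig
    !hornerE/=; ring.
rewrite (_ : (fun y => _) = fun y => gauss_trig r (2 * pi * r) 0 k%:P y +
  gauss_trig (- r) (2 * pi * - r) 0 (k * eps)%:P y).
  by apply: gauss_trig_span_add; exact: gauss_trig_span_gen.
by apply/funext => y; rewrite /coherent_pair /coherent /expi /gauss_trig
  !hornerE/=; ring.
Qed.

End schwartz.

Local Close Scope complex_scope.

Theorem corollary5p15 (R : realType) :
  exists phi0 : R -> R[i],
    [/\ schwartz phi0,
        cL2norm phi0 = 1%E,
        1 < Cintegral (@lebesgue_measure R \x @lebesgue_measure R)%E
              [set p : R * R | 0 <= p.1 /\ 0 <= p.2] (wigner phi0 phi0) &
        exists a : R, 0 < a /\
          1 < Cintegral (@lebesgue_measure R \x @lebesgue_measure R)%E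
                [set p : R * R | 0 <= p.1 <= a /\ 0 <= p.2 <= a]
                (wigner phi0 phi0)].
Proof.
pose r : R := 3; pose eps : R := 50^-1 ^+ 2.
have eps0 : 0 <= eps by rewrite sqr_ge0.
have quadrant := quadrant_wigner_pair_gt1 (erefl r) (erefl eps).
exists (coherent_pair r eps (Num.sqrt (sqr_norm r eps))^-1); split.
- exact: schwartz_coherent_pair.
- exact: cL2norm_coherent_pair.
- by rewrite Cintegral_wigner_pair ltcE/= eqxx/=; exact: quadrant.
- have [a a0 square] := square_wigner_pair_gt1 (integrable_wigner_pair r eps _) quadrant.
  exists a; split=> //.
  by rewrite Cintegral_wigner_pair ltcE/= eqxx/=; exact: square.
Qed.
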